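(* Let $(\Theta,\Psi)$ be a pair of symmetric matrices, $\Theta\in\mathbb{R}^{p\times p}$, $\Psi\in\mathbb{R}^{q\times q}$, with $\Theta\oplus\Psi$ positive definite. Within the equivalence class containing $(\Theta,\Psi)$, i.e. among all pairs $(\Theta-cI_p,\Psi+cI_q)$ with $c\in\mathbb{R}$, the gradient $G=(G_\Theta,G_\Psi)$, the Hessian $H$ and the approximate Hessian $\hat H$ are uniquely defined: each takes the same value at every member of the class. Consequently the second-order approximation $$\hat g(\Delta_\Theta,\Delta_\Psi)=\operatorname{vec}(G)^T\begin{bmatrix}\operatorname{vec}(\Delta_\Theta)\\\operatorname{vec}(\Delta_\Psi)\end{bmatrix}+\frac12\begin{bmatrix}\operatorname{vec}(\Delta_\Theta)\\\operatorname{vec}(\Delta_\Psi)\end{bmatrix}^TH\begin{bmatrix}\operatorname{vec}(\Delta_\Theta)\\\operatorname{vec}(\Delta_\Psi)\end{bmatrix}$$ (and likewise the one with $\hat H$ in place of $H$) is uniquely defined, i.e. is the same function of $(\Delta_\Theta,\Delta_\Psi)$ for every member of the class.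
   Context: $p,q,n\ge1$ are integers, $1\le K\le\min\{p,q\}$ is an integer. $I_a$ is the $a\times a$ identity, $\otimes$ the Kronecker product, $\Theta\oplus\Psi=\Theta\otimes I_q+I_p\otimes\Psi$, $\operatorname{vec}$ stacks columns, and $e_{a,i}$ is the $i$th standard basis vector of $\mathbb{R}^a$. Given data $Y^1,\dots,Y^n\in\mathbb{R}^{q\times p}$, $S=\frac1{nq}\sum_iY^{iT}Y^i$, $T=\frac1{np}\sum_iY^iY^{iT}$, and $g(\Theta,\Psi)=q\operatorname{tr}(S\Theta)+p\operatorname{tr}(T\Psi)-\log|\Theta\oplus\Psi|$. With $W=(\Theta\oplus\Psi)^{-1}$, the gradient of $g$ has blocks $G_\Theta=qS-\sum_{i=1}^q(I_p\otimes e_{q,i})^TW(I_p\otimes e_{q,i})$ and $G_\Psi=pT-\sum_{j=1}^p(e_{p,j}\otimes I_q)^TW(e_{p,j}\otimes I_q)$, with $\operatorname{vec}(G)=[\operatorname{vec}(G_\Theta)^T,\operatorname{vec}(G_\Psi)^T]^T$; the Hessian is $H=P^T(W\otimes W)P$ with $P=[\sum_{i=1}^qI_p\otimes e_{q,i}\otimes I_p\otimes e_{q,i},\ \sum_{j=1}^pe_{p,j}\otimes I_q\otimes e_{p,j}\otimes I_q]$. Approximate Hessian: write $\Theta=Q_\Theta\Lambda_\Theta Q_\Theta^T$, $\Psi=Q_\Psi\Lambda_\Psi Q_\Psi^T$ with eigenvalues $\lambda_{\Theta,1}\le\dots\le\lambda_{\Theta,p}$ and $\lambda_{\Psi,1}\le\dots\le\lambda_{\Psi,q}$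 on the diagonals, $\Xi_{\Theta,k}=(\Lambda_\Theta+\lambda_{\Psi,k}I_p)^{-1}$, $\Xi_{\Psi,l}=(\Lambda_\Psi+\lambda_{\Theta,l}I_q)^{-1}$. Then $\hat H$ is block diagonal with blocks $\hat H_\Theta=(Q_\Theta\otimes Q_\Theta)\hat\Lambda_{H_\Theta}(Q_\Theta\otimes Q_\Theta)^T$ and $\hat H_\Psi=(Q_\Psi\otimes Q_\Psi)\hat\Lambda_{H_\Psi}(Q_\Psi\otimes Q_\Psi)^T$, where $\hat\Lambda_{H_\Theta}=\sum_{k=1}^K\Xi_{\Theta,k}\otimes\Xi_{\Theta,k}+(q-K)\,\Xi_{\Theta,K}\otimes\Xi_{\Theta,K}$ and $\hat\Lambda_{H_\Psi}=\sum_{l=1}^K\Xi_{\Psi,l}\otimes\Xi_{\Psi,l}+(p-K)\,\Xi_{\Psi,K}\otimes\Xi_{\Psi,K}$. *)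

(* Defs.v *)
(* The real numbers are an arbitrary realType R. *)
From mathcomp Require Import all_boot all_order all_algebra.
From mathcomp Require Import reals.
From mathcomp.real_closed Require Export mxtens.

Set Implicit Arguments.
Unset Strict Implicit.
Unset Printing Implicit Defensive.

Import GRing.Theory Num.Theory.
Local Open Scope ring_scope.

Section Defs.
Variable R : realType.

Definition posdef (a : nat) (A : 'M[R]_a) : Prop :=
  A^T = A /\ forall x : 'cV[R]_a, x != 0 -> 0 < (x^T *m A *m x) 0 0.

(* Column stacking: the entry (i, j) of an m x k matrix goes to position
   j * m + i.  The same indexing of pairs is used by [tensmx]. *)
Definition vec (m k : nat) (A : 'M[R]_(m, k)) : 'cV[R]_(k * m) :=
  \col_t A (mxtens_unindex t).2 (mxtens_unindex t).1.

Lemma vecE (m k : nat) (A : 'M[R]_(m, k)) i j :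
  vec A (mxtens_index (j, i)) 0 = A i j.
Proof. by rewrite mxE mxtens_indexK. Qed.

Definition stdbasis (a : nat) (i : 'I_a) : 'cV[R]_a := delta_mx i 0.

Section KroneckerSum.
Variables p q : nat.

Definition kronsum (Theta : 'M[R]_p) (Psi : 'M[R]_q) : 'M[R]_(p * q) :=
  Theta *t 1%:M + 1%:M *t Psi.

(* The casts only identify p * 1 with p and 1 * q with q. *)
Definition I_tens_e (i : 'I_q) : 'M[R]_(p * q, p) :=
  castmx (erefl, muln1 p) ((1%:M : 'M[R]_p) *t stdbasis i).

Definition e_tens_I (j : 'I_p) : 'M[R]_(p * q, q) :=
  castmx (erefl, mul1n q) (stdbasis j *t (1%:M : 'M[R]_q)).

Definition Wmx (Theta : 'M[R]_p) (Psi : 'M[R]_q) : 'M[R]_(p * q) :=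
  invmx (kronsum Theta Psi).

Section Gradient.
Variables (n : nat) (Y : 'I_n -> 'M[R]_(q, p)).

Definition Smx : 'M[R]_p := (n * q)%:R^-1 *: \sum_i ((Y i)^T *m Y i).

Definition Tmx : 'M[R]_q := (n * p)%:R^-1 *: \sum_i (Y i *m (Y i)^T).

Definition grad_Theta (Theta : 'M[R]_p) (Psi : 'M[R]_q) : 'M[R]_p :=
  q%:R *: Smx
  - \sum_(i < q) ((I_tens_e i)^T *m Wmx Theta Psi *m I_tens_e i).

Definition grad_Psi (Theta : 'M[R]_p) (Psi : 'M[R]_q) : 'M[R]_q :=
  p%:R *: Tmx
  - \sum_(j < p) ((e_tens_I j)^T *m Wmx Theta Psi *m e_tens_I j).

Definition vec_pair (A : 'M[R]_p) (B : 'M[R]_q) : 'cV[R]_(p * p + q * q) :=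
  col_mx (vec A) (vec B).

Definition vec_grad (Theta : 'M[R]_p) (Psi : 'M[R]_q) :=
  vec_pair (grad_Theta Theta Psi) (grad_Psi Theta Psi).

End Gradient.

Definition Pmx : 'M[R]_((p * q) * (p * q), p * p + q * q) :=
  row_mx (\sum_(i < q) (I_tens_e i *t I_tens_e i))
         (\sum_(j < p) (e_tens_I j *t e_tens_I j)).

Definition hessian (Theta : 'M[R]_p) (Psi : 'M[R]_q) :
    'M[R]_(p * p + q * q) :=
  Pmx^T *m (Wmx Theta Psi *t Wmx Theta Psi) *m Pmx.

(* [vG] stands for vec(G) and [M] for H or its approximation. *)
Definition ghat (vG : 'cV[R]_(p * p + q * q)) (M : 'M[R]_(p * p + q * q))
    (DTheta : 'M[R]_p) (DPsi : 'M[R]_q) : R :=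
  (vG^T *m vec_pair DTheta DPsi
   + 2^-1 *: ((vec_pair DTheta DPsi)^T *m M *m vec_pair DTheta DPsi)) 0 0.

End KroneckerSum.

(* A = Q Lambda Q^T with Q orthogonal and Lambda = diag d, d nondecreasing. *)
Definition eigendecomposition (a : nat) (A Q : 'M[R]_a) (d : 'rV[R]_a) : Prop :=
  [/\ Q^T *m Q = 1%:M,
      A = Q *m diag_mx d *m Q^T
    & forall i j : 'I_a, (i <= j)%N -> d 0 i <= d 0 j].

(* The k-th diagonal entry, counted from 1.  Values of k outside of
   1 <= k <= a are never reached when 1 <= K <= min p q. *)
Definition eigval (a : nat) (d : 'rV[R]_a) (k : nat) : R :=
  oapp (d 0) 0 (insub k.-1 : option 'I_a).

(* Xi d1 d2 k = (diag d1 + (k-th entry of d2) I)^-1. *)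
Definition Xi (a b : nat) (d1 : 'rV[R]_a) (d2 : 'rV[R]_b) (k : nat) : 'M[R]_a :=
  invmx (diag_mx d1 + (eigval d2 k)%:M).

(* With (a, b) = (p, q) this is the Theta block, with (a, b) = (q, p) the Psi
   block. *)
Definition approx_Lambda (K a b : nat) (d1 : 'rV[R]_a) (d2 : 'rV[R]_b) :
    'M[R]_(a * a) :=
  \sum_(1 <= k < K.+1) (Xi d1 d2 k *t Xi d1 d2 k)
  + (b - K)%:R *: (Xi d1 d2 K *t Xi d1 d2 K).

Definition approx_block (K a b : nat) (Q : 'M[R]_a) (d1 : 'rV[R]_a)
    (d2 : 'rV[R]_b) : 'M[R]_(a * a) :=
  (Q *t Q) *m approx_Lambda K d1 d2 *m (Q *t Q)^T.

(* A relation rather than a function, since the eigenvector matrices are not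
   unique: [M] is the approximate Hessian built from some choice of sorted
   eigendecompositions of [Theta] and [Psi]. *)
Definition is_approx_hessian (K p q : nat) (Theta : 'M[R]_p) (Psi : 'M[R]_q)
    (M : 'M[R]_(p * p + q * q)) : Prop :=
  exists (QT : 'M[R]_p) (dT : 'rV[R]_p) (QP : 'M[R]_q) (dP : 'rV[R]_q),
    [/\ eigendecomposition Theta QT dT,
        eigendecomposition Psi QP dP
      & M = block_mx (approx_block K QT dT dP) 0 0 (approx_block K QP dP dT)].

End Defs.

Arguments vec_grad {R p q n} Y Theta Psi.
Arguments grad_Theta {R p q n} Y Theta Psi.
Arguments grad_Psi {R p q n} Y Theta Psi.

(* Main.v *)
(* W, hence G and H, depends on the pair only through Theta (+) Psi, which the
   shift by c does not change.  For the approximate Hessian, conjugating the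
   diagonal matrices Xi by the eigenvector matrices gives (Theta + mu I)^-1,
   with mu an eigenvalue of Psi; this involves the eigenvalues only, so it does
   not depend on the choice of eigenvectors, and the opposite shifts of Theta
   and mu cancel.  Existence of a sorted eigendecomposition is the real spectral
   theorem: a real eigenvalue comes from the complex Hermitian case, and a
   Householder reflection splits off the corresponding eigenvector. *)
Require Import Defs.
From mathcomp Require Import all_boot all_order all_fingroup all_algebra.
From mathcomp Require Import reals.
From mathcomp.real_closed Require Import complex.

Set Implicit Arguments.
Unset Strict Implicit.
Unset Printing Implicit Defensive.

Import Order.TTheory GRing.Theory Num.Theory.
Local Open Scope ring_scope.

(** * Spectral theorem for real symmetric matrices *)

Lemma mulmx_tr_eq0 (F : realDomainType) n (w : 'rV[F]_n) :
  (w *m w^T == 0) = (w == 0).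
Proof.
apply/eqP/eqP => [w0|->]; last by rewrite mul0mx.
apply/rowP => i; rewrite mxE.
have /matrixP/(_ 0 0) := w0; rewrite !mxE => /eqP.
rewrite psumr_eq0 => [|j _]; last by rewrite !mxE -expr2 sqr_ge0.
move=> /allP/(_ i); rewrite mem_index_enum !mxE -expr2 sqrf_eq0.
by move=> /(_ isT)/eqP.
Qed.

(* Householder reflection in the hyperplane orthogonal to u - v. *)
Lemma exists_reflection (F : realFieldType) n (u v : 'rV[F]_n) :
  u *m u^T = v *m v^T ->
  exists Q : 'M[F]_n, [/\ Q^T = Q, Q *m Q = 1%:M & u *m Q = v].
Proof.
move=> uv; have [->|neq_uv] := eqVneq u v.
  by exists 1%:M; split; rewrite ?trmx1 ?mulmx1.
set w := u - v; have w_neq0 : w != 0 by rewrite subr_eq0.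
set s := (w *m w^T) 0 0.
have ws : w *m w^T = s%:M by rewrite [LHS]mx11_scalar.
have s_neq0 : s != 0.
  apply: contra_neq w_neq0 => s0; apply/eqP.
  by rewrite -mulmx_tr_eq0 ws s0 raddf0.
have vu : v *m u^T = u *m v^T.
  by rewrite -[LHS]trmxK trmx_mul trmxK [LHS]mx11_scalar [RHS]mx11_scalar mxE.
(* Since [u] and [v] have equal norms, the squared norm [s] of [w] is twice the inner product of [u]
   and [w]; the factor [2 / s] then removes exactly [w] from [u], leaving [v]. *)
have uw : u *m w^T = (s / 2)%:M.
  apply: (scalerI (a := 2)); first by rewrite pnatr_eq0.
  rewrite scale_scalar_mx mulrC divfK ?pnatr_eq0 // -ws /w.
  rewrite linearB /= mulmxBl !mulmxBr vu -uv scaler_nat mulr2n.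
  by rewrite opprB addrACA.
have uwv : u - w = v by rewrite /w opprB addrC subrK.
clearbody w; exists (1%:M - (2 / s) *: (w^T *m w)); split.
- by rewrite linearB linearZ /= trmx1 trmx_mul trmxK.
- have H2 : (w^T *m w) *m (w^T *m w) = s *: (w^T *m w).
    by rewrite mulmxA -[_ *m w *m _]mulmxA ws mul_mx_scalar -scalemxAl.
  rewrite mulmxBl mul1mx mulmxBr mulmx1 -scalemxAl -scalemxAr H2 !scalerA.
  by rewrite -[_ * s]mulrA divfK // opprB -scalerBl mulr_natr mulr2n addrK subrK.
- rewrite mulmxBr mulmx1 -scalemxAr mulmxA uw mul_scalar_mx scalerA.
  by rewrite mulrA divfK // divff ?pnatr_eq0 // scale1r.
Qed.

Lemma symmetric_eigenvalue (R : rcfType) n (A : 'M[R]_n.+1) :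
  A^T = A -> exists a, eigenvalue A a.
Proof.
move=> symA; pose C : numClosedFieldType := R[i].
pose f : {rmorphism R -> C} := real_complex R; pose B := map_mx f A.
have Bherm : B \is hermsymmx.
  apply: realsym_hermsym.
    apply/is_hermitianmxP.
    by rewrite expr0 scale1r map_mx_id // /B -[in RHS]symA map_trmx trmxK.
  apply/mxOverP => i j; rewrite mxE.
  by apply/complex_realP; exists (A i j).
have /mxOverP/(_ 0 0)/complex_realP[a a_eq] :=
  @hermitian_spectral_diag_real _ _ _ Bherm.
(* The characteristic polynomial has coefficients in [R], so its root [f a] in [R[i]] descends to
   the root [a]. *)
exists a; rewrite eigenvalue_root_char -(fmorph_root f) map_char_poly.
rewrite -eigenvalue_root_char.
have /orthomx_spectralP Beq := hermitian_normalmx Bherm.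
apply/eigenvalueP; exists (row 0 (spectralmx B)).
  have PB : spectralmx B *m B = diag_mx (spectral_diag B) *m spectralmx B.
    by rewrite [in X in _ *m X]Beq -mulmxA mulKVmx // spectral_unit.
  by rewrite -row_mul PB row_mul row_diag_mx -scalemxAl -rowE a_eq.
(* A zero row in the invertible spectral matrix would force a zero row in the identity. *)
apply/eqP => row0.
have /mulmxV/(congr1 (row 0))/eqP := spectral_unit B.
rewrite row_mul row0 mul0mx => /eqP/rowP/(_ 0)/eqP.
by rewrite !mxE eqxx eq_sym oner_eq0.
Qed.

(** Induction on the size: reflecting the first axis onto an eigenvector leaves a 1 x 1 eigenvalue
    block and a smaller symmetric block. *)
Lemma symmetric_diagonalization (R : rcfType) n (A : 'M[R]_n) :
  A^T = A ->
  exists Q (d : 'rV_n), Q^T *m Q = 1%:M /\ A = Q *m diag_mx d *m Q^T.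
Proof.
elim: n => [|n IHn] in A * => symA.
  by exists 1%:M, 0; split; apply/matrixP => -[].
have [a /eigenvalueP[v vA v_neq0]] := @symmetric_eigenvalue R n A symA.
(* [r] is the norm of [v]: a reflection can only carry a multiple of the first basis vector to [v]
   if the norms agree. *)
pose r := Num.sqrt ((v *m v^T) 0 0).
have r2 : r ^+ 2 = (v *m v^T) 0 0.
  by rewrite sqr_sqrtr // mxE sumr_ge0 // => j _; rewrite mxE -expr2 sqr_ge0.
have r_neq0 : r != 0.
  apply: contra_neq v_neq0 => r0; apply/eqP.
  by rewrite -mulmx_tr_eq0 [_ *m _]mx11_scalar -r2 r0 expr0n raddf0.
have [|Q [symQ QQ eQ]] := @exists_reflection _ _ (r *: delta_mx 0 0) v.
  rewrite [RHS]mx11_scalar -r2 linearZ -scalemxAl -scalemxAr /= trmx_delta.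
  by rewrite mul_delta_mx scalerA -expr2 [delta_mx _ _]mx11_scalar mxE !eqxx scalemx1.
pose B : 'M_(1 + n) := Q *m A *m Q.
have AE : A = Q *m B *m Q.
  by rewrite /B !mulmxA QQ mul1mx -mulmxA QQ mulmx1.
have symB : B^T = B by rewrite /B !trmx_mul symQ symA mulmxA.
(* With e the first basis vector, r e B = v A Q = a v Q = a r e, the last equality because [Q] is an
   involution. Symmetry of [B] then clears the first column too. *)
have row0B : row 0 B = a *: delta_mx 0 0.
  apply: (scalerI r_neq0); rewrite rowE /B !mulmxA !scalemxAl eQ vA -eQ.
  by rewrite -!scalemxAl -mulmxA QQ mulmx1 !scalerA mulrC.
clearbody B; have B0E (i : 'I_1) j : B (lshift n i) j = a * (j == lshift n i)%:R.
  have -> : lshift n i = 0 :> 'I_(1 + n) by apply: val_inj; rewrite /= ord1.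
  by have /rowP/(_ j) := row0B; rewrite !mxE eqxx.
have BE : B = block_mx a%:M 0 0 (drsubmx B).
  rewrite -[LHS]submxK; congr block_mx; apply/matrixP => i j; rewrite !mxE.
  - by rewrite B0E !ord1 eqxx mulr1.
  - by rewrite B0E eq_rlshift mulr0.
  - by rewrite -symB mxE B0E eq_rlshift mulr0.
have [|Q' [d' [Q'Q' B'E]]] := IHn (drsubmx B).
  by rewrite trmx_drsub symB.
pose P : 'M_(1 + n) := block_mx 1%:M 0 0 Q'.
have PP : P^T *m P = 1%:M.
  rewrite tr_block_mx mulmx_block !trmx0 trmx1 !(mulmx0, mul0mx, addr0, add0r).
  by rewrite Q'Q' mulmx1 -scalar_mx_block.
exists (Q *m P), (row_mx a%:M d'); split.
  by rewrite trmx_mul symQ mulmxA -[_ *m Q *m Q]mulmxA QQ mulmx1.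
suff BP : B = P *m diag_mx (row_mx a%:M d') *m P^T.
  by rewrite AE BP trmx_mul symQ !mulmxA.
rewrite diag_mx_row tr_block_mx !mulmx_block !trmx0 trmx1.
rewrite !(mulmx0, mul0mx, addr0, add0r, mulmx1, mul1mx) BE B'E.
by congr block_mx; apply/matrixP => i j; rewrite !mxE !ord1 mulr1n.
Qed.

(** * Orthogonal conjugation and sorted eigendecompositions *)

Lemma char_poly_conj (R : comUnitRingType) n (Q B : 'M[R]_n) :
  Q^T *m Q = 1%:M -> char_poly (Q *m B *m Q^T) = char_poly B.
Proof.
move=> /mulmx1C QQ; pose P := map_mx polyC Q.
have PP : P *m P^T = 1%:M by rewrite /P map_trmx -map_mxM QQ map_mx1.
have -> : char_poly (Q *m B *m Q^T) = \det (P *m char_poly_mx B *m P^T).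
  rewrite /char_poly /char_poly_mx mulmxBr mulmxBl !map_mxM -map_trmx.
  by rewrite mul_mx_scalar -scalemxAl PP scalemx1.
by rewrite !det_mulmx mulrAC -det_mulmx PP det1 mul1r.
Qed.

Lemma invmx_conj (R : comUnitRingType) n (Q B : 'M[R]_n) :
  Q^T *m Q = 1%:M -> invmx (Q *m B *m Q^T) = Q *m invmx B *m Q^T.
Proof.
move=> QQ; have QQ' := mulmx1C QQ.
have [Qu Qtu] := mulmx1_unit QQ'.
have [Bu|nBu] := boolP (B \in unitmx); last first.
  (* On a singular matrix [invmx] returns its argument, and conjugation preserves singularity, so
     both sides are the conjugate of [B]. *)
  by rewrite !invmx_out // inE /= !unitmx_mul Qu Qtu andbT.
have Cu : Q *m B *m Q^T \in unitmx by rewrite !unitmx_mul Qu Qtu Bu.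
apply: (can_inj (mulKmx Cu)); rewrite mulmxV // !mulmxA.
by rewrite -[_ *m Q^T *m Q]mulmxA QQ mulmx1 mulmxK.
Qed.

(** The permutation that sorts the eigenvalues is applied to the columns of [Q] as well, which only
    reorders the sum of rank-one terms. *)
Lemma eigendecomposition_exists (R : realType) n (A : 'M[R]_n) :
  A^T = A -> exists Q d, eigendecomposition A Q d.
Proof.
move=> /symmetric_diagonalization[Q [d [QQ ->]]].
pose t := [tuple d 0 i | i < n].
have /tuple_permP[s st] : perm_eq (sort <=%O t) t by rewrite perm_sort.
have dE i : d 0 (s i) = nth 0 (sort <=%O t) i.
  by rewrite st -tnth_nth !tnth_mktuple.
exists (col_perm s Q), (col_perm s d); split.
- apply/matrixP => i j; have /matrixP/(_ (s i) (s j)) := QQ; rewrite !mxE.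
  rewrite (inj_eq perm_inj) => <-.
  by apply: eq_bigr => k _; rewrite !mxE.
- apply/matrixP => i j; rewrite !mxE (reindex_perm s); apply: eq_bigr => k _ /=.
  by rewrite !mul_mx_diag !mxE.
- move=> i j ij; rewrite !mxE !dE.
  by rewrite le_sorted_leq_nth ?sort_le_sorted // inE size_sort size_tuple.
Qed.

(** The characteristic polynomial determines the eigenvalues as a multiset, and a multiset has only
    one sorted listing. *)
Lemma eigenvalues_unique (R : realType) n (A Q Q' : 'M[R]_n) d d' :
  eigendecomposition A Q d -> eigendecomposition A Q' d' -> d = d'.
Proof.
move=> [QQ -> dmono] [QQ' AE d'mono].
have := congr1 char_poly AE.
rewrite !char_poly_conj // !char_poly_trig ?diag_mx_is_trig //.
have E (e : 'rV[R]_n) : \prod_(i < n) ('X - (diag_mx e i i)%:P)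
    = \prod_(x <- [tuple e 0 i | i < n]) ('X - x%:P).
  rewrite big_tuple; apply: eq_bigr => i _.
  by rewrite tnth_mktuple mxE eqxx mulr1n.
rewrite !E => /prod_XsubC_eq dd'.
have sorted_tuple (e : 'rV[R]_n) :
    (forall i j : 'I_n, (i <= j)%N -> e 0 i <= e 0 j) ->
    sorted <=%O [tuple e 0 i | i < n].
  move=> emono; apply/(sortedP 0) => i; rewrite size_tuple => lt_in.
  have lt_in' := ltnW lt_in.
  have := emono (Ordinal lt_in') (Ordinal lt_in) (leqnSn i).
  rewrite -[e 0 _](tnth_mktuple (e 0)) -[e 0 (Ordinal lt_in)](tnth_mktuple (e 0)).
  by rewrite !(tnth_nth 0).
have tt' := le_sorted_eq (sorted_tuple _ dmono) (sorted_tuple _ d'mono) dd'.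
apply/rowP => i; have /(congr1 (fun s => nth 0 s i)) := tt'.
by rewrite -!tnth_nth !tnth_mktuple.
Qed.

Lemma eigendecomposition_shift (R : realType) n (A Q : 'M[R]_n) d c :
  eigendecomposition A Q d -> eigendecomposition (A + c%:M) Q (d + const_mx c).
Proof.
move=> [QQ -> dmono]; split=> // [|i j ij]; last by rewrite !mxE lerD2r dmono.
rewrite raddfD /= diag_const_mx mulmxDr mulmxDl mul_mx_scalar -scalemxAl.
by rewrite (mulmx1C QQ) scalemx1.
Qed.

(** The range of [k] keeps [eigval] away from its default value 0, which would not move with [c]. *)
Lemma eigval_shift (R : realType) n (d : 'rV[R]_n) c k : (0 < k <= n)%N ->
  eigval (d + const_mx c) k = eigval d k + c.
Proof.
case: k => // k /= lt_kn; rewrite /eigval /=.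
by case: insubP => [i _ _|]; rewrite ?lt_kn //= !mxE.
Qed.


(** * Approximate Hessian in terms of resolvents *)

Lemma eigendecomposition_invmx (R : realType) n (A Q : 'M[R]_n) d x :
  eigendecomposition A Q d ->
  Q *m invmx (diag_mx d + x%:M) *m Q^T = invmx (A + x%:M).
Proof.
move=> [QQ -> _]; rewrite -invmx_conj // mulmxDr mulmxDl mul_mx_scalar.
by rewrite -scalemxAl (mulmx1C QQ) scalemx1.
Qed.

(** Form of a Hessian block free of eigenvectors: only [A] itself and the eigenvalues of the other
    matrix enter. *)
Definition resolvent_approx (R : realType) (K a b : nat) (A : 'M[R]_a)
    (d : 'rV[R]_b) : 'M[R]_(a * a) :=
  let N k := invmx (A + (eigval d k)%:M) in
  \sum_(1 <= k < K.+1) N k *t N k + (b - K)%:R *: (N K *t N K).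

(** By the mixed-product rule, conjugation by [Q *t Q] acts on each tensor factor separately and
    turns each [Xi] into a resolvent of [A]. *)
Lemma approx_blockE (R : realType) K a b (A Q : 'M[R]_a) d1 (d2 : 'rV[R]_b) :
  eigendecomposition A Q d1 -> approx_block K Q d1 d2 = resolvent_approx K A d2.
Proof.
move=> AQ; have XE k : (Q *t Q) *m (Xi d1 d2 k *t Xi d1 d2 k) *m (Q *t Q)^T
    = invmx (A + (eigval d2 k)%:M) *t invmx (A + (eigval d2 k)%:M).
  by rewrite trmx_tens !tensmx_mul !(eigendecomposition_invmx _ AQ).
rewrite /approx_block /approx_Lambda mulmxDr mulmxDl mulmx_sumr mulmx_suml.
rewrite -scalemxAr -scalemxAl XE /resolvent_approx; congr (_ + _).
by apply: eq_bigr => k _; rewrite XE.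
Qed.

Lemma resolvent_approx_shift (R : realType) K a b (A : 'M[R]_a)
    (d : 'rV[R]_b) c :
  (0 < K <= b)%N ->
  resolvent_approx K (A - c%:M) (d + const_mx c) = resolvent_approx K A d.
Proof.
move=> /andP[K0 Kb].
have NE k : (0 < k <= b)%N ->
    A - c%:M + (eigval (d + const_mx c) k)%:M = A + (eigval d k)%:M.
  by move=> kb; rewrite eigval_shift // [_ + c]addrC raddfD /= subrKA.
rewrite /resolvent_approx NE ?K0 //; congr (_ + _).
by apply: eq_big_nat => k /andP[k0 kK]; rewrite NE // k0 (leq_trans _ Kb).
Qed.

Lemma is_approx_hessian_unique (R : realType) K p q (A : 'M[R]_p)
    (B : 'M[R]_q) M M' :
  is_approx_hessian K A B M -> is_approx_hessian K A B M' -> M = M'.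
Proof.
move=> [Q1 [d1 [Q2 [d2 [AQ BQ ->]]]]] [Q1' [d1' [Q2' [d2' [AQ' BQ' ->]]]]].
rewrite (approx_blockE _ _ AQ) (approx_blockE _ _ BQ).
rewrite (approx_blockE _ _ AQ') (approx_blockE _ _ BQ').
by rewrite (eigenvalues_unique AQ AQ') (eigenvalues_unique BQ BQ').
Qed.

Lemma is_approx_hessian_exists (R : realType) K p q (A : 'M[R]_p)
    (B : 'M[R]_q) :
  A^T = A -> B^T = B -> exists M, is_approx_hessian K A B M.
Proof.
move=> /eigendecomposition_exists[Q1 [d1 AQ]].
move=> /eigendecomposition_exists[Q2 [d2 BQ]].
by eexists; exists Q1, d1, Q2, d2.
Qed.

Lemma is_approx_hessian_shift (R : realType) K p q (A : 'M[R]_p)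
    (B : 'M[R]_q) M c :
  (0 < K <= minn p q)%N ->
  is_approx_hessian K A B M -> is_approx_hessian K (A - c%:M) (B + c%:M) M.
Proof.
rewrite leq_min => /and3P[K0 Kp Kq] [Q1 [d1 [Q2 [d2 [AQ BQ ->]]]]].
have AQc := eigendecomposition_shift (- c) AQ.
have BQc := eigendecomposition_shift c BQ.
rewrite raddfN /= in AQc.
exists Q1, (d1 + const_mx (- c)), Q2, (d2 + const_mx c); split=> //.
rewrite (approx_blockE _ _ AQ) (approx_blockE _ _ BQ).
rewrite (approx_blockE _ _ AQc) (approx_blockE _ _ BQc).
rewrite resolvent_approx_shift ?K0 //.
(* The second block is shifted in the opposite direction, so the shift lemma is used with [- c]. *)
have -> : B + c%:M = B - (- c)%:M by rewrite raddfN opprK.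
by rewrite resolvent_approx_shift ?K0.
Qed.

(** * Invariance of the Kronecker sum, and conclusion *)

Lemma kronsum_shift (R : realType) p q (A : 'M[R]_p) (B : 'M[R]_q) c :
  kronsum (A - c%:M) (B + c%:M) = kronsum A B.
Proof.
rewrite /kronsum; apply/matrixP => i j; rewrite !mxE.
rewrite mulrDl mulrDr addrACA -[RHS]addr0; congr (_ + _).
(* The two shifts contribute [- c] and [c] times the same product of Kronecker deltas. *)
set k := _ == _; set l := _ == _.
by rewrite mulNr mulr_natr mulr_natl mulrnAC addNr.
Qed.

Theorem lemma6 (R : realType) (p q n K : nat)
  (hp : (1 <= p)%N) (hq : (1 <= q)%N) (hn : (1 <= n)%N)
  (hK : (1 <= K <= minn p q)%N)
  (Y : 'I_n -> 'M[R]_(q, p))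
  (Theta : 'M[R]_p) (Psi : 'M[R]_q)
  (symTheta : Theta^T = Theta) (symPsi : Psi^T = Psi)
  (pd : posdef (kronsum Theta Psi)) :
  exists (GTheta : 'M[R]_p) (GPsi : 'M[R]_q)
         (H Hhat : 'M[R]_(p * p + q * q)),
  forall c : R,
    let Thetac := Theta - c%:M in
    let Psic := Psi + c%:M in
    [/\ grad_Theta Y Thetac Psic = GTheta /\ grad_Psi Y Thetac Psic = GPsi,
        hessian Thetac Psic = H,
        (forall M : 'M[R]_(p * p + q * q),
           is_approx_hessian K Thetac Psic M <-> M = Hhat)
      & forall (DTheta : 'M[R]_p) (DPsi : 'M[R]_q),
          ghat (vec_grad Y Thetac Psic) (hessian Thetac Psic) DTheta DPsi
            = ghat (vec_pair GTheta GPsi) H DTheta DPsi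
          /\ forall M : 'M[R]_(p * p + q * q),
               is_approx_hessian K Thetac Psic M ->
               ghat (vec_grad Y Thetac Psic) M DTheta DPsi
                 = ghat (vec_pair GTheta GPsi) Hhat DTheta DPsi].
Proof.
have WE c : Wmx (Theta - c%:M) (Psi + c%:M) = Wmx Theta Psi.
  by rewrite /Wmx kronsum_shift.
(* All four witnesses are taken at the member [c = 0] of the class. *)
have [Hhat HhatP] := is_approx_hessian_exists K symTheta symPsi.
exists (grad_Theta Y Theta Psi), (grad_Psi Y Theta Psi).
exists (hessian Theta Psi), Hhat.
move=> c Thetac Psic.
have GT : grad_Theta Y Thetac Psic = grad_Theta Y Theta Psi.
  by rewrite /grad_Theta WE.
have GP : grad_Psi Y Thetac Psic = grad_Psi Y Theta Psi.
  by rewrite /grad_Psi WE.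
have HE : hessian Thetac Psic = hessian Theta Psi by rewrite /hessian WE.
have ME M : is_approx_hessian K Thetac Psic M <-> M = Hhat.
  (* [Hhat] is transported along the shift; uniqueness at the shifted pair then gives the
     equivalence. *)
  have Hc : is_approx_hessian K Thetac Psic Hhat.
    exact: is_approx_hessian_shift.
  by split=> [HM|->//]; apply: is_approx_hessian_unique HM Hc.
split=> // DTheta DPsi; rewrite /vec_grad GT GP HE.
by split=> // M /ME ->.
Qed.
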